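(* Let $H$ be a graph and let $r \geq 300\,v(H)^9$ be an integer. Then $H$ is $K_{r+1}$-Turán-good; that is, for all sufficiently large $n$, $\mathrm{ex}(n,H,K_{r+1}) = \mathcal{N}(H,T_r(n))$.
   Context: $v(H)$ denotes the number of vertices of $H$. $\mathcal{N}(H,G)$ is the number of subgraphs of $G$ isomorphic to $H$. $\mathrm{ex}(n,H,F)$ is the maximum of $\mathcal{N}(H,G)$ over all $n$-vertex graphs $G$ containing no subgraph isomorphic to $F$. The Turán graph $T_r(n)$ is the complete $r$-partite graph on $n$ vertices whose parts have sizes $\lfloor n/r\rfloor$ or $\lceil n/r\rceil$. For a graph $F$ of chromatic number $k+1$, a graph $H$ is called $F$-Turán-good if $\mathrm{ex}(n,H,F)=\mathcal{N}(H,T_k(n))$ for all sufficiently large $n$. *)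

(* Defs.v *)
From mathcomp Require Import all_boot.
Set Implicit Arguments. Unset Strict Implicit. Unset Printing Implicit Defensive.

(* A (finite simple) graph on the vertex set 'I_n is given by its edge set,
   a set of 2-element subsets of 'I_n. *)
Definition simple_graph (n : nat) (E : {set {set 'I_n}}) : bool :=
  [forall e in E, #|e| == 2].

(* Subgraphs (V', E') of G isomorphic to H: V' is the image of an injective
   map f : V(H) -> V(G), and E' = f(E(H)) must consist of edges of G. *)
Definition copies (h n : nat) (H : {set {set 'I_h}}) (G : {set {set 'I_n}})
  : {set {set 'I_n} * {set {set 'I_n}}} :=
  [set p | [exists f : {ffun 'I_h -> 'I_n},
     [&& injectiveb f, p.1 == f @: [set: 'I_h],
         p.2 == [set (f @: e : {set 'I_n}) | e : {set 'I_h} in H] & p.2 \subset G]]].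

Definition Nsub (h n : nat) (H : {set {set 'I_h}}) (G : {set {set 'I_n}}) : nat :=
  #|copies H G|.

Definition complete (k : nat) : {set {set 'I_k}} := [set e : {set 'I_k} | #|e| == 2].

(* The Turan graph T_r(n): vertex u lies in part (u mod r); parts have sizes
   floor(n/r) or ceil(n/r); two vertices are adjacent iff in different parts. *)
Definition turan (r n : nat) : {set {set 'I_n}} :=
  [set e : {set 'I_n} | [exists u : 'I_n, exists v : 'I_n,
      (u %% r != v %% r) && (e == [set u; v])]].

Definition ex (n h k : nat) (H : {set {set 'I_h}}) (F : {set {set 'I_k}}) : nat :=
  \max_(G : {set {set 'I_n}} | simple_graph G && (Nsub F G == 0)) Nsub H G.

(* Main.v *)
Require Import Defs.
From mathcomp Require Import all_boot fingroup perm zify.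
Set Implicit Arguments. Unset Strict Implicit. Unset Printing Implicit Defensive.

(** Count injective edge-preserving maps, i.e. copies times |Aut H|. In an
    extremal graph G, turning a vertex into a twin of another one cannot increase
    the count, so all vertices lie in almost equally many copies, and comparison
    with T_r(n), which keeps almost all maps, bounds every codegree by D = n / O(h^3).
    Füredi's greedy choice of maximum-degree vertices splits V(G) into r parts, each
    inside a non-neighbourhood, such that at least twice as many cross pairs are
    missing as there are edges inside the parts. As degrees are nearly full, each missing
    pair destroys almost as many maps as an inner edge could possibly create, so
    G is complete r-partite. If two of its parts differ by at least 2, moving a
    vertex from the larger to the smaller creates more maps, so G is balanced. *)

(** * Union bound and its disjoint counterpart *)

Lemma card_sum_bool (T : finType) (Q : pred T) :
  #|[set x | Q x]| = \sum_x (Q x : nat).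
Proof. by rewrite -sum1dep_card big_mkcond; apply: eq_bigr => x _; case: (Q x). Qed.

Lemma card_cover_le (T P : finType) (A : {set T}) (Q : pred P) (F : P -> {set T}) :
  (forall x, x \in A -> exists2 p, Q p & x \in F p) ->
  #|A| <= \sum_(p | Q p) #|F p|.
Proof.
move=> cov; have sub: A \subset \bigcup_(p | Q p) F p.
  by apply/subsetP => x /cov [p Qp xF]; apply/bigcupP; exists p.
apply: leq_trans (subset_leq_card sub) _.
elim/big_rec2: _ => [|p m B _ IH]; first by rewrite cards0.
by apply: leq_trans (leq_card_setU _ _).1 _; rewrite leq_add2l.
Qed.

Lemma card_disjoint_ge (T P : finType) (A : {set T}) (Q : pred P) (F : P -> {set T}) :
  (forall p, Q p -> F p \subset A) ->
  (forall p q x, Q p -> Q q -> x \in F p -> x \in F q -> p = q) ->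
  \sum_(p | Q p) #|F p| <= #|A|.
Proof.
move=> sub dis.
have -> : \sum_(p | Q p) #|F p| = \sum_(x in A) \sum_(p | Q p) (x \in F p : nat).
  rewrite exchange_big /=; apply: eq_bigr => p Qp.
  rewrite -big_mkcondr /= sum1dep_card; congr #|pred_of_set _|; apply/setP => x.
  by rewrite inE andb_idl // => /(subsetP (sub p Qp)).
rewrite -sum1_card leq_sum // => x _.
have [p /andP [Qp xp]|none] := pickP (fun p => Q p && (x \in F p)).
  rewrite (bigD1 p) //= xp big1 // => q /andP [Qq nqp].
  by apply/eqP; rewrite eqb0; apply: contra nqp => xq; apply/eqP; apply: (dis _ _ x).
rewrite big1 // => p Qp; move: (none p); rewrite Qp /= => ->; exact: erefl.
Qed.

(** * Counting maps with conditions on a few coordinates *)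

Section Counting.
Variables (h n : nat).
Implicit Types (f : {ffun 'I_h -> 'I_n}) (a b c d : 'I_h).

Definition upd f d (x : 'I_n) : {ffun 'I_h -> 'I_n} :=
  [ffun i => if i == d then x else f i].

Lemma upd_other f d x a : a != d -> upd f d x a = f a.
Proof. by move=> nad; rewrite ffunE (negPf nad). Qed.

(* The involution (f, x) |-> (f with value x at d, f d) exchanges the two sides. *)
Lemma sum_upd d (P : {ffun 'I_h -> 'I_n} -> 'I_n -> nat) :
  (forall f x y, P (upd f d x) y = P f y) ->
  n * \sum_f P f (f d) = \sum_f \sum_x P f x.
Proof.
move=> inv.
have -> : n * \sum_f P f (f d) = \sum_f \sum_(x < n) P f (f d).
  by rewrite big_distrr; apply: eq_bigr => f _; rewrite sum_nat_const card_ord.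
rewrite !pair_big /=.
pose phi (p : {ffun 'I_h -> 'I_n} * 'I_n) := (upd p.1 d p.2, p.1 d).
have phiK : involutive phi.
  case=> f x; rewrite /phi /=; congr pair; last by rewrite ffunE eqxx.
  by apply/ffunP => i; rewrite !ffunE; case: eqP => // ->.
rewrite (reindex_inj (inv_inj phiK)) /=; apply: eq_bigr => -[f x] _ /=.
by rewrite inv ffunE eqxx.
Qed.

Definition at_pair (R : rel 'I_n) a b := [set f : {ffun 'I_h -> 'I_n} | R (f a) (f b)].

Definition rsize (R : rel 'I_n) := \sum_u \sum_v (R u v : nat).

(** The values at [a] and [b] are resampled one after the other by [sum_upd]. Multiplying by [n ^ 2]
    avoids the exponent [h - 2], truncated for small [h]. *)
Lemma card_at_pair R a b : a != b -> n ^ 2 * #|at_pair R a b| = rsize R * n ^ h.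
Proof.
move=> nab; rewrite expnS expn1 -mulnA card_sum_bool.
rewrite (@sum_upd b (fun f y => R (f a) y : nat)); last first.
  by move=> f x y; rewrite upd_other.
rewrite (@sum_upd a (fun _ x => \sum_y (R x y : nat))) //.
by rewrite sum_nat_const card_ffun !card_ord mulnC.
Qed.

Lemma card_at_point a v : n * #|[set f : {ffun 'I_h -> 'I_n} | f a == v]| = n ^ h.
Proof.
rewrite card_sum_bool (@sum_upd a (fun _ x => x == v : nat)) //.
rewrite sum_nat_const card_ffun !card_ord (bigD1 v) //= eqxx big1 ?muln1 //.
by move=> x /negPf ->.
Qed.

(** Neither [Q f] nor [S f] depends on the value at [d], so after resampling that value it falls
    into [S f] with probability at most [D / n]. *)
Lemma card_upd_le d (Q : pred {ffun 'I_h -> 'I_n}) (S : {ffun 'I_h -> 'I_n} -> pred 'I_n) D :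
  (forall f x, Q (upd f d x) = Q f) -> (forall f x, S (upd f d x) =1 S f) ->
  (forall f, #|[set y | S f y]| <= D) ->
  n * #|[set f : {ffun 'I_h -> 'I_n} | Q f && S f (f d)]| <= D * #|[set f : {ffun 'I_h -> 'I_n} | Q f]|.
Proof.
move=> invQ invS leD.
rewrite card_sum_bool (@sum_upd d (fun f x => Q f && S f x : nat)); last first.
  by move=> f x y; rewrite invQ invS.
rewrite card_sum_bool big_distrr /=; apply: leq_sum => f _.
case: (Q f) => /=; last by rewrite big1.
by rewrite muln1 -(card_sum_bool (S f)).
Qed.

Definition off_pair a b c d := (c \notin [:: a; b]) || (d \notin [:: a; b]).

Definition good_off (bad : rel 'I_n) a b f :=
  [forall c, forall d, (c != d) && off_pair a b c d ==> ~~ bad (f c) (f d)].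

(** A pair of coordinates other than [{a, b}] has a member outside [{a, b}]. Resampling this member
    makes the pair bad with conditional probability at most [D / n], so the union bound over at most
    [h ^ 2] pairs spoils at most a quarter of the maps. *)
Lemma card_good_off (bad : rel 'I_n) (R : rel 'I_n) D a b :
  symmetric bad -> (forall x, #|[set y | bad x y]| <= D) -> 4 * h ^ 2 * D <= n ->
  a != b ->
  3 * #|at_pair R a b| <= 4 * #|[set f in at_pair R a b | good_off bad a b f]|.
Proof.
move=> bad_sym leD hD nab; set E := at_pair R a b.
have [n0|n_gt0] := posnP n.
  suff -> : E = set0 by rewrite cards0.
  by apply/setP => f; have := ltn_ord (f a); rewrite [X in _ < X]n0.
set G := [set f in E | _].
pose bads (p : 'I_h * 'I_h) := [set f : {ffun 'I_h -> 'I_n} | (f \in E) && bad (f p.1) (f p.2)].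
(* Symmetry of [bad] allows the free coordinate to be put second. *)
pose Q (p : 'I_h * 'I_h) := (p.1 != p.2) && (p.2 \notin [:: a; b]).
have cov : #|E :\: G| <= \sum_(p | Q p) #|bads p|.
  apply: card_cover_le => f; rewrite !inE => /andP [nG Ef]; move: nG; rewrite Ef /=.
  rewrite negb_forall => /existsP [c]; rewrite negb_forall => /existsP [d].
  rewrite negb_imply negbK => /andP [/andP [ncd off] bcd].
  case/orP: off => out.
    by exists (d, c); [rewrite /Q /= eq_sym ncd out | rewrite !inE Ef /= bad_sym].
  by exists (c, d); [rewrite /Q /= ncd out | rewrite !inE Ef /=].
have le1 p : Q p -> n * #|bads p| <= D * #|E|.
  case: p => c d /andP [/= ncd out].
  move: out; rewrite !inE negb_or => /andP [nda ndb].
  have -> : #|E| = #|[set f : {ffun 'I_h -> 'I_n} | R (f a) (f b)]| by [].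
  rewrite /bads /=.
  rewrite (_ : [set f : {ffun 'I_h -> 'I_n} | _] = [set f : {ffun 'I_h -> 'I_n} | R (f a) (f b) && bad (f c) (f d)]); last first.
    by apply/setP => f; rewrite !inE.
  apply: (@card_upd_le d (fun f => R (f a) (f b)) (fun f => bad (f c))) => //.
    by move=> f x; rewrite !upd_other // eq_sym.
  by move=> f x y; rewrite upd_other.
have le2 : n * #|E :\: G| <= h ^ 2 * D * #|E|.
  apply: leq_trans (leq_mul (leqnn n) cov) _; rewrite big_distrr /=.
  apply: (leq_trans (n := \sum_(p | Q p) D * #|E|)); first exact: leq_sum.
  rewrite sum_nat_const -mulnA leq_mul2r; apply/orP; right.
  by apply: leq_trans (max_card _) _; rewrite card_prod !card_ord.
have le3 : 4 * #|E :\: G| <= #|E|.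
  rewrite -(leq_pmul2l n_gt0) mulnCA; apply: leq_trans (leq_mul (leqnn 4) le2) _.
  by rewrite mulnA leq_mul2r mulnA hD orbT.
have := cardsID G E; rewrite (setIidPr _); last by apply/subsetP => f; rewrite inE => /andP [].
lia.
Qed.

End Counting.

(** * Embeddings, and twin symmetrization in extremal graphs *)

Definition emb (h n : nat) (eH : rel 'I_h) (g : rel 'I_n) : {set {ffun 'I_h -> 'I_n}} :=
  [set f : {ffun 'I_h -> 'I_n} | injectiveb f && [forall a, forall b, eH a b ==> g (f a) (f b)]].

Lemma embP (h n : nat) (eH : rel 'I_h) (g : rel 'I_n) (f : {ffun 'I_h -> 'I_n}) :
  reflect (injective f /\ forall a b, eH a b -> g (f a) (f b)) (f \in emb eH g).
Proof.
rewrite inE; apply: (iffP andP) => -[/injectiveP injf H]; split=> //.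
  by move=> a b eab; move: H => /forallP /(_ a) /forallP /(_ b) /implyP; apply.
by apply/forallP => a; apply/forallP => b; apply/implyP; apply: H.
Qed.

Definition clique (n : nat) (g : rel 'I_n) (T : {set 'I_n}) :=
  forall x y, x \in T -> y \in T -> x != y -> g x y.

Definition clique_free (n r : nat) (g : rel 'I_n) :=
  forall T : {set 'I_n}, clique g T -> #|T| <= r.

Definition extremal (h n r : nat) (eH : rel 'I_h) (g : rel 'I_n) :=
  [/\ symmetric g, irreflexive g, clique_free r g &
    forall g' : rel 'I_n, symmetric g' -> irreflexive g' -> clique_free r g' ->
      #|emb eH g'| <= #|emb eH g|].

(** The number of non-neighbours, with [v] itself among them when [g] is irreflexive. *)
Definition codeg (n : nat) (g : rel 'I_n) (v : 'I_n) := #|[set y | ~~ g v y]|.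

Section Twins.
Variables (h n r : nat) (eH : rel 'I_h) (g : rel 'I_n).
Hypothesis ext : extremal r eH g.

Definition emb_at (v : 'I_n) := [set f in emb eH g | v \in codom f].

Definition twin (v w : 'I_n) (x : 'I_n) := if x == v then w else x.

(** Zykov symmetrization: let [v] become a twin of [w]. Embeddings avoiding [v] survive, and each
    embedding through [w] avoiding [v] yields a new one with [v] in place of [w]. By extremality the
    latter are no more than the embeddings through [v] that were given up; the error term bounds the
    embeddings through both vertices. *)
Lemma card_emb_at_le v w : n ^ 2 * #|emb_at w| <= n ^ 2 * #|emb_at v| + h ^ 2 * n ^ h.
Proof.
have [-> | nvw] := eqVneq w v; first exact: leq_addr.
case: ext => gsym girr gfree gmax.
pose g' := relpre (twin v w) g.
have g'free : clique_free r g'.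
  move=> T clT.
  (* No clique of [g'] contains both [v] and [w], so its image under [twin] is a clique of [g] of
     the same size. *)
  have injT : {in T &, injective (twin v w)}.
    move=> x y xT yT eqxy; apply/eqP; apply: contraT => /(clT _ _ xT yT).
    by rewrite /g' /= eqxy girr.
  rewrite -(card_in_imset injT); apply: gfree => _ _ /imsetP [x xT ->] /imsetP [y yT ->] nxy.
  by apply: clT => //; apply: contraNneq nxy => ->.
have le' : #|emb eH g'| <= #|emb eH g|.
  by apply: gmax => // [x y|x]; rewrite /g' /= ?girr // gsym.
pose A := [set f in emb eH g | v \notin codom f].
pose B := [set f in emb_at w | v \notin codom f].
pose sw (f : {ffun 'I_h -> 'I_n}) : {ffun 'I_h -> 'I_n} := [ffun x => tperm v w (f x)].
have swinj : injective sw.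
  move=> f1 f2 /ffunP eq12; apply/ffunP => x; move: (eq12 x); rewrite !ffunE; exact: perm_inj.
have disj : [disjoint A & sw @: B].
  rewrite disjoints_subset; apply/subsetP => f; rewrite !inE => /andP [_ nvf].
  apply/imsetP => -[f1]; rewrite !inE => /andP [/andP [_ /codomP [x wx]] _] eqf.
  by case/negP: nvf; apply/codomP; exists x; rewrite eqf ffunE -wx tpermR.
have subA : A \subset emb eH g'.
  apply/subsetP => f; rewrite inE => /andP [/embP [injf Hf] nvf]; apply/embP; split=> // a b.
  have tw c : twin v w (f c) = f c.
    by rewrite /twin; case: eqP => // fc; case/negP: nvf; rewrite -fc codom_f.
  by move/Hf; rewrite /g' /= !tw.
have subB : sw @: B \subset emb eH g'.
  apply/subsetP => _ /imsetP [f + ->].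
  rewrite 2!inE => /andP [/andP [/embP [injf Hf] _] nvf]; apply/embP; split.
    by move=> x y; rewrite !ffunE => /perm_inj /injf.
  move=> a b.
  have tw c : twin v w (sw f c) = f c.
    rewrite ffunE /twin; case: tpermP => [fc|->|nv nw]; last by case: eqP.
      by case/negP: nvf; rewrite -fc codom_f.
    by rewrite eqxx.
  by move/Hf; rewrite /g' /= !tw.
have le1 : #|A| + #|B| <= #|emb eH g|.
  have <- : #|sw @: B| = #|B| by apply: card_imset.
  rewrite -cardsUI (disjoint_setI0 disj) cards0 addn0.
  by apply: leq_trans le'; apply: subset_leq_card; rewrite subUset subA.
have eA : #|emb_at v| + #|A| = #|emb eH g|.
  rewrite -(cardsID [set f : {ffun 'I_h -> 'I_n} | v \in codom f] (emb eH g)).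
  by congr (_ + _); apply: eq_card => f; rewrite !inE // andbC.
pose C := [set f in emb_at w | v \in codom f].
have eC : #|C| + #|B| = #|emb_at w|.
  rewrite -(cardsID [set f : {ffun 'I_h -> 'I_n} | v \in codom f] (emb_at w)).
  by congr (_ + _); apply: eq_card => f; rewrite !inE // andbC.
pose R : rel 'I_n := fun x y => (x == w) && (y == v).
have szR : rsize R = 1.
  rewrite /rsize (bigD1 w) //= (bigD1 v) //= /R !eqxx !big1 //.
    by move=> x /negPf ->; rewrite big1.
  by move=> x /negPf ->.
have cC : #|C| <= \sum_(p : 'I_h * 'I_h | p.1 != p.2) #|at_pair R p.1 p.2|.
  apply: card_cover_le => f; rewrite !inE => /andP [/andP [_ /codomP [a fa]] /codomP [b fb]].
  exists (a, b); rewrite /= ?inE /R -?fa -?fb ?eqxx //.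
  by apply: contraNneq nvw => ab; rewrite fa fb ab.
have cC2 : n ^ 2 * #|C| <= h ^ 2 * n ^ h.
  apply: leq_trans (leq_mul (leqnn _) cC) _; rewrite big_distrr /=.
  rewrite (eq_bigr (fun=> n ^ h)); last first.
    by move=> p np; rewrite card_at_pair // szR mul1n.
  rewrite sum_nat_const leq_mul2r; apply/orP; right.
  by apply: leq_trans (max_card _) _; rewrite card_prod !card_ord.
rewrite -eC mulnDr addnC; apply: leq_add => //; rewrite leq_mul2l; apply/orP; right; lia.
Qed.

Lemma sum_emb_at : \sum_v #|emb_at v| = h * #|emb eH g|.
Proof.
have e v : #|emb_at v| = \sum_(f in emb eH g) (v \in codom f : nat).
  by rewrite -big_mkcondr /= sum1dep_card; apply: eq_card => f; rewrite !inE.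
rewrite (eq_bigr _ (fun v _ => e v)) exchange_big /= mulnC -sum_nat_const.
apply: eq_bigr => f /embP [injf _].
rewrite -(card_sum_bool (mem (codom f))) -[RHS]card_ord -(card_codom injf).
by apply: eq_card => x; rewrite !inE.
Qed.

(** Each of the [h] choices of the vertex of H placed at [v] gives at most [n ^ (h - 1)] maps. When
    [a0] is placed there, the maps sending [b0] to a non-neighbour of [v] are lost as well; they
    number [codeg g v] times [n ^ (h - 2)]. *)
Lemma card_emb_at_codeg a0 b0 v : eH a0 b0 -> a0 != b0 ->
  n ^ 2 * #|emb_at v| + codeg g v * n ^ h <= h * n * n ^ h.
Proof.
move=> e0 nab; pose F (a : 'I_h) := [set f : {ffun 'I_h -> 'I_n} | (f \in emb eH g) && (f a == v)].
have cov : #|emb_at v| <= \sum_a #|F a|.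
  apply: card_cover_le => f; rewrite inE => /andP [fe /codomP [a fa]].
  by exists a => //; rewrite inE fe fa /=.
have leF a : n * #|F a| <= n ^ h.
  rewrite -(card_at_point a v) leq_mul2l; apply/orP; right.
  by apply: subset_leq_card; apply/subsetP => f; rewrite !inE => /andP [].
pose R : rel 'I_n := fun x y => (x == v) && ~~ g v y.
have szR : rsize R = codeg g v.
  rewrite /rsize (bigD1 v) //= /R eqxx /= /codeg card_sum_bool -[RHS]addn0; congr (_ + _).
  by rewrite big1 // => x /negPf ->; rewrite big1.
have leF0 : n ^ 2 * #|F a0| + codeg g v * n ^ h <= n * n ^ h.
  rewrite -szR -(card_at_pair R nab) -(card_at_point a0 v) mulnA -mulnDr leq_mul2l.
  apply/orP; right; rewrite -cardsUI (_ : _ :&: _ = set0) ?cards0 ?addn0.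
    apply: subset_leq_card; apply/subsetP => f; rewrite in_setU => /orP [].
      by rewrite [f \in F a0]inE inE => /andP [].
    by rewrite !inE => /andP [].
  apply/setP => f; rewrite in_setI [f \in set0]inE; apply/negP => /andP [].
  rewrite [f \in F a0]inE => /andP [/embP [_ Hf] /eqP fa]; rewrite inE.
  by case/andP => _; rewrite -{1}fa Hf.
have leS : n ^ 2 * \sum_(a | a != a0) #|F a| <= h.-1 * n * n ^ h.
  rewrite big_distrr /= (leq_trans (n := \sum_(a | a != a0) n * n ^ h)) //.
    by apply: leq_sum => a _; rewrite expnS expn1 -mulnA leq_mul2l leF orbT.
  rewrite sum_nat_const mulnA.
  by rewrite (_ : #|_| = h.-1) // cardC1 card_ord.
have h_gt0 : 0 < h by case: (h) a0 {e0 nab leF0 leS} => // -[].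
apply: (leq_trans (n := n ^ 2 * \sum_a #|F a| + codeg g v * n ^ h)).
  by rewrite leq_add2r leq_mul2l cov orbT.
rewrite (bigD1 a0) //= mulnDr.
have -> : h * n * n ^ h = n * n ^ h + h.-1 * n * n ^ h by rewrite -{1}(prednK h_gt0); nia.
by rewrite addnAC; apply: leq_add.
Qed.

End Twins.

(** * Complete multipartite graphs and the codegree bound *)

Definition multipartite (n : nat) (J : eqType) (kappa : 'I_n -> J) : rel 'I_n :=
  fun u v => kappa u != kappa v.

Lemma multipartite_sym n (J : eqType) (kappa : 'I_n -> J) : symmetric (multipartite kappa).
Proof. by move=> u v; rewrite /multipartite eq_sym. Qed.

Lemma multipartite_irr n (J : eqType) (kappa : 'I_n -> J) : irreflexive (multipartite kappa).
Proof. by move=> u; rewrite /multipartite eqxx. Qed.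

Lemma multipartite_clique_free n r (kappa : 'I_n -> 'I_r) : clique_free r (multipartite kappa).
Proof.
move=> T clT; have inj : {in T &, injective kappa}.
  move=> x y xT yT exy; apply/eqP; apply: contraT => /(clT _ _ xT yT).
  by rewrite /multipartite exy eqxx.
by rewrite -(card_in_imset inj) -[X in _ <= X]card_ord max_card.
Qed.

(** A map whose values have pairwise different colours is an embedding of any H; the union bound
    counts the maps with a repeated colour. *)
Lemma card_emb_multipartite_ge h n (J : eqType) (eH : rel 'I_h) (kappa : 'I_n -> J) D :
  irreflexive eH -> (forall x, #|[set y | kappa x == kappa y]| <= D) ->
  n * n ^ h <= n * #|emb eH (multipartite kappa)| + h ^ 2 * D * n ^ h.
Proof.
move=> irrH leD; set K := emb _ _.
pose F (p : 'I_h * 'I_h) := at_pair (fun x y => kappa x == kappa y) p.1 p.2.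
have cov : #|~: K| <= \sum_(p | p.1 != p.2) #|F p|.
  apply: card_cover_le => f; rewrite in_setC => nK.
  have [p /andP [np Fp]|none] := pickP (fun p => (p.1 != p.2) && (f \in F p)); first by exists p.
  have ne a b : a != b -> kappa (f a) != kappa (f b).
    by move=> nab; move: (none (a, b)); rewrite nab inE /= => ->.
  case/negP: nK; apply/embP; split.
    by move=> a b fab; apply/eqP; apply: contraT => /ne; rewrite fab eqxx.
  by move=> a b eab; apply: ne; apply: contraTneq eab => ->; rewrite irrH.
have leF p : p.1 != p.2 -> n * #|F p| <= D * n ^ h.
  move=> np; rewrite -(_ : #|[set f : {ffun 'I_h -> 'I_n} | true]| = n ^ h); last first.
    by rewrite cardsT card_ffun !card_ord.
  by apply: (@card_upd_le _ _ p.2 (fun=> true) (fun f y => kappa (f p.1) == kappa y))=> // f x y; rewrite upd_other.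
have leC : n * #|~: K| <= h ^ 2 * D * n ^ h.
  apply: leq_trans (leq_mul (leqnn n) cov) _; rewrite big_distrr /=.
  apply: (leq_trans (n := \sum_(p : 'I_h * 'I_h | p.1 != p.2) D * n ^ h)); first exact: leq_sum.
  rewrite sum_nat_const -mulnA leq_mul2r; apply/orP; right.
  by apply: leq_trans (max_card _) _; rewrite card_prod !card_ord.
have := cardsC K; rewrite card_ffun !card_ord => eK.
by rewrite -[X in n * X <= _]eK mulnDr leq_add2l.
Qed.

(** By twins, [v] lies in almost the average number of embeddings, and comparison with the
    multipartite graph makes this average almost [h * n ^ (h - 1)]. By [card_emb_at_codeg] little
    room remains for non-neighbours. The term [h ^ 3 * D] is [h] times the multipartite loss, and
    [h ^ 2] is the twin error. *)
Lemma codeg_le h n r (eH : rel 'I_h) (g : rel 'I_n) (kappa : 'I_n -> 'I_r) D a0 b0 v :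
  extremal r eH g -> irreflexive eH -> eH a0 b0 ->
  (forall x, #|[set y | kappa x == kappa y]| <= D) ->
  codeg g v <= h ^ 3 * D + h ^ 2.
Proof.
move=> ext irrH e0 leD.
have n_gt0 : 0 < n by case: (v) => m; apply: leq_ltn_trans.
have nab : a0 != b0 by apply: contraTneq e0 => ->; rewrite irrH.
have ext' := ext; case: ext' => _ _ _ /(_ _ (multipartite_sym kappa)
  (multipartite_irr kappa) (@multipartite_clique_free _ _ kappa)) leT.
have lowT := card_emb_multipartite_ge irrH leD.
have avg : n ^ 2 * (h * #|emb eH g|) <= n * (n ^ 2 * #|emb_at eH g v|) + n * (h ^ 2 * n ^ h).
  rewrite -sum_emb_at big_distrr /= -mulnDr -[X in X * _](card_ord n) -sum_nat_const.
  by apply: leq_sum => w _; apply: card_emb_at_le ext _ _.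
have up := card_emb_at_codeg g v e0 nab.
set X := n ^ h in lowT avg up.
have X_gt0 : 0 < X by rewrite expn_gt0 n_gt0.
set E := #|emb eH g| in leT avg; set T := #|emb _ _| in leT lowT.
set c := codeg g v in up *; set m := #|emb_at _ _ _| in avg up.
have h1 : n * h * (n * X) <= n * h * (n * E + h ^ 2 * D * X).
  by rewrite leq_mul2l; apply/orP; right; apply: leq_trans lowT _; rewrite leq_add2r leq_mul2l leT orbT.
have h2 : n * (n ^ 2 * m) + n * (c * X) <= n * (h * n * X) by rewrite -mulnDr leq_mul2l up orbT.
have : n * X * c <= n * X * (h ^ 3 * D + h ^ 2).
  have e1 : n * h * (n * E + h ^ 2 * D * X) = n ^ 2 * (h * E) + n * X * (h ^ 3 * D) by lia.
  have e2 : n * (h * n * X) = n * h * (n * X) by lia.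
  have e3 : n * (h ^ 2 * X) = n * X * h ^ 2 by lia.
  have e4 : n * (c * X) = n * X * c by lia.
  rewrite e1 in h1; rewrite e2 e4 in h2; rewrite e3 in avg.
  rewrite mulnDr; lia.
by rewrite leq_pmul2l // muln_gt0 n_gt0.
Qed.

(** * Füredi's partition by maximum-degree vertices *)

Lemma sum2_setID (T : finType) (S N : {set T}) (F : T -> T -> nat) :
  \sum_(u in S) \sum_(v in S) F u v =
  (\sum_(u in S :&: N) \sum_(v in S :&: N) F u v +
   \sum_(u in S :&: N) \sum_(v in S :\: N) F u v) +
  (\sum_(u in S :\: N) \sum_(v in S :&: N) F u v +
   \sum_(u in S :\: N) \sum_(v in S :\: N) F u v).
Proof.
rewrite (big_setID N) /= -!big_split /=.
by congr (_ + _); apply: eq_bigr => u _; rewrite (big_setID N).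
Qed.

Section Furedi.
Variables (n D : nat) (g : rel 'I_n).
Hypotheses (gsym : symmetric g) (girr : irreflexive g).
Hypothesis leD : forall v, codeg g v <= D.

(* Colour by the non-neighbourhoods of a greedy clique of maximum-degree vertices. *)
Lemma greedy_partition k (S : {set 'I_n}) :
  (forall T : {set 'I_n}, T \subset S -> clique g T -> #|T| <= k) ->
  exists kappa : 'I_n -> nat,
  [/\ forall x, x \in S -> kappa x < k,
      forall x, x \in S -> #|[set y in S | kappa x == kappa y]| <= D &
      2 * \sum_(u in S) \sum_(v in S) (g u v && (kappa u == kappa v) : nat) <=
      \sum_(u in S) \sum_(v in S) (~~ g u v && (kappa u != kappa v) : nat)].
Proof.
elim: k S => [|k IH] S free.
  exists (fun=> 0); have S0 x : x \in S -> False.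
    move=> xS; have := free [set x]; rewrite sub1set cards1 => /(_ xS) H.
    by suff: 1 <= 0 by []; apply: H => y z /set1P -> /set1P ->; rewrite eqxx.
  split=> [x /S0 //|x /S0 //|]; rewrite big1 // => x /S0 //.
have [->|[v0 v0S]] := set_0Vmem S.
  by exists (fun=> 0); split=> [x|x|]; rewrite ?inE // !big_set0.
pose dg v := \sum_(y in S) (g v y : nat).
have [v1 v1S dgmax] : exists2 v1, v1 \in S & forall v, v \in S -> dg v <= dg v1.
  by case: (arg_maxnP dg v0S) => v1 v1S dgmax; exists v1.
pose N := [set y | g v1 y].
(* A clique among the neighbours of [v1] can be enlarged by [v1], so the induction hypothesis
   applies with [k]. *)
have free' (T : {set 'I_n}) : T \subset S :&: N -> clique g T -> #|T| <= k.
  rewrite subsetI => /andP [TS /subsetP TN] clT.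
  have v1T : v1 \notin T by apply/negP => /TN; rewrite inE girr.
  have := free (v1 |: T); rewrite cardsU1 v1T add1n ltnS; apply.
    by rewrite subUset sub1set v1S.
  move=> x y /setU1P [->|xT] /setU1P [->|yT]; rewrite ?eqxx // => nxy; last exact: clT.
    by move: (TN _ yT); rewrite inE.
  by move: (TN _ xT); rewrite inE gsym.
have [kap [kap_lt kap_sz kap_B]] := IH _ free'.
(* The non-neighbours of [v1], at most [D] many, form the new part with the fresh colour [k]. *)
exists (fun x => if g v1 x then kap x else k).
have SI x : x \in S :&: N -> (g v1 x) * (kap x < k).
  by move=> xI; rewrite kap_lt //; move: xI; rewrite !inE => /andP [_ ->].
have SD x : x \in S :\: N -> g v1 x = false by rewrite !inE => /andP [/negPf ->].
split.
- by move=> x xS; case: ifP => // gx; rewrite ltnS ltnW // kap_lt // !inE xS.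
- move=> x xS; case: ifP => gx.
    have xI : x \in S :&: N by rewrite !inE xS.
    apply: leq_trans (kap_sz _ xI); apply: subset_leq_card; apply/subsetP => y.
    rewrite !inE; case: ifP => gy; rewrite ?andbT //.
    by move/andP => [_ /eqP ek]; move: (kap_lt _ xI); rewrite ek ltnn.
  apply: leq_trans (leD v1); apply: subset_leq_card; apply/subsetP => y.
  rewrite !inE; case: ifP => // gy /andP [yS /eqP ek].
  by have := kap_lt y; rewrite !inE yS gy -ek ltnn => /(_ isT).
rewrite !(sum2_setID S N).
set I := S :&: N; set O := S :\: N.
have lt_neq x : x \in I -> (kap x == k) = false.
  by move=> /SI [_ lt]; apply/negbTE; rewrite neq_ltn lt.
(* A vertex [u] of [O] has degree at most that of [v1], which is the size of [I]. Hence its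
   neighbours in [O] are no more than its non-neighbours in [I]. *)
have key : \sum_(u in O) \sum_(v in O) (g u v : nat) <=
           \sum_(u in O) \sum_(v in I) (~~ g u v : nat).
  apply: leq_sum => u uO.
  have uS : u \in S by move: uO; rewrite inE => /andP [].
  have := dgmax u uS; rewrite /dg (big_setID N) [X in _ <= X](big_setID N) /=.
  rewrite -/I -/O [X in _ <= _ + X]big1 => [|y /SD -> //].
  have <- : \sum_(v in I) (g u v : nat) + \sum_(v in I) (~~ g u v : nat) =
    \sum_(v in I) (g v1 v : nat).
    by rewrite -big_split /=; apply: eq_bigr => y /SI [-> _]; case: (g u y).
  by rewrite addn0 leq_add2l.
(* Missing pairs between [I] and [O] occur in both orders, while [key] uses one order only: this
   yields the factor 2. *)
have swap : \sum_(u in I) \sum_(v in O) (~~ g u v : nat) =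
            \sum_(u in O) \sum_(v in I) (~~ g u v : nat).
  by rewrite exchange_big; apply: eq_bigr => u _; apply: eq_bigr => v _; rewrite gsym.
apply: (leq_trans (n := 2 * (\sum_(u in I) \sum_(v in I) (g u v && (kap u == kap v) : nat) +
   \sum_(u in O) \sum_(v in O) (g u v : nat)))).
  rewrite leq_mul2l /= [X in _ + X + _]big1 ?addn0; last first.
    move=> u uI; rewrite big1 // => v vO.
    by rewrite (SI u uI) (SD v vO) (lt_neq u uI) andbF.
  rewrite [X in _ + (X + _)]big1 ?add0n; last first.
    move=> u uO; rewrite big1 // => v vI.
    by rewrite (SI v vI) (SD u uO) eq_sym (lt_neq v vI) andbF.
  apply: leq_add; apply: leq_sum => u uI; apply: leq_sum => v vI.
    by rewrite (SI v vI) (SI u uI).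
  by case: (g u v) => //=; case: (_ == _).
have -> : \sum_(u in I) \sum_(v in I)
     (~~ g u v && ((if g v1 u then kap u else k) != (if g v1 v then kap v else k)) : nat) =
     \sum_(u in I) \sum_(v in I) (~~ g u v && (kap u != kap v) : nat).
  by apply: eq_bigr => u uI; apply: eq_bigr => v vI; rewrite (SI v vI) (SI u uI).
have -> : \sum_(u in I) \sum_(v in O)
     (~~ g u v && ((if g v1 u then kap u else k) != (if g v1 v then kap v else k)) : nat) =
     \sum_(u in I) \sum_(v in O) (~~ g u v : nat).
  apply: eq_bigr => u uI; apply: eq_bigr => v vO.
  by rewrite (SI u uI) (SD v vO) (lt_neq u uI) andbT.
have -> : \sum_(u in O) \sum_(v in I)
     (~~ g u v && ((if g v1 u then kap u else k) != (if g v1 v then kap v else k)) : nat) =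
     \sum_(u in O) \sum_(v in I) (~~ g u v : nat).
  apply: eq_bigr => u uI; apply: eq_bigr => v vI.
  by rewrite (SI v vI) (SD u uI) eq_sym (lt_neq v vI) andbT.
rewrite swap; move: kap_B key; rewrite -/I; lia.
Qed.
End Furedi.

(** * An extremal graph is complete multipartite *)

Section CompareMultipartite.
Variables (h n D : nat) (eH : rel 'I_h) (g : rel 'I_n) (J : eqType) (kappa : 'I_n -> J).
Hypotheses (symH : symmetric eH) (irrH : irreflexive eH).
Hypothesis gsym : symmetric g.
Hypothesis codegD : forall v, codeg g v <= D.
Hypothesis partD : forall x, #|[set y | kappa x == kappa y]| <= D.
Hypothesis smallD : 8 * h ^ 2 * D <= n.

Definition inner : rel 'I_n := fun u v => g u v && (kappa u == kappa v).
Definition missing : rel 'I_n := fun u v => ~~ g u v && (kappa u != kappa v).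

Hypothesis inner_missing : 2 * rsize inner <= rsize missing.

Let K := emb eH (multipartite kappa).
(** Every edge of H is listed once, smaller end first; otherwise the families counted below would
    overlap. *)
Let edges (p : 'I_h * 'I_h) := (p.1 < p.2) && eH p.1 p.2.

Let edge_neq p : edges p -> p.1 != p.2.
Proof. by case/andP => lt _; rewrite neq_ltn lt. Qed.

(** An embedding into [g] whose edges all join different parts would lie in [K], so some edge is
    sent to an inner pair. *)
Lemma card_emb_not_multipartite :
  #|emb eH g :\: K| <= \sum_(p | edges p) #|at_pair inner p.1 p.2|.
Proof.
apply: card_cover_le => f; rewrite in_setD => /andP [nK /embP [injf Hf]].
have [p /andP [ep Fp]|none] := pickP (fun p => edges p && (f \in at_pair inner p.1 p.2)).
  by exists p.
have ne a b : edges (a, b) -> multipartite kappa (f a) (f b).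
  move=> eab; move: (none (a, b)); rewrite eab inE /inner /= => /negbT.
  by rewrite Hf //; case/andP: eab.
case/negP: nK; apply/embP; split=> // a b eab.
have [lt|lt|/val_inj ab] := ltngtP a b; first by apply: ne; rewrite /edges /= lt.
  by rewrite multipartite_sym; apply: ne; rewrite /edges /= lt symH.
by move: eab; rewrite ab irrH.
Qed.

(* Maps spoiled by exactly one missing pair are counted without overlap. *)
Lemma card_multipartite_not_emb :
  3 * \sum_(p | edges p) #|at_pair missing p.1 p.2| <= 4 * #|K :\: emb eH g|.
Proof.
(* If one edge of H goes to a missing pair and no other pair is bad, all colours differ: the map
   lies in [K], and fails for [g] at that edge. Bad degrees are at most [2 * D], whence the 8 in
   [smallD]. *)
pose bad : rel 'I_n := fun x y => (kappa x == kappa y) || ~~ g x y.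
have bad_sym : symmetric bad by move=> x y; rewrite /bad eq_sym gsym.
have badD x : #|[set y | bad x y]| <= 2 * D.
  rewrite (_ : [set y | bad x y] = [set y | kappa x == kappa y] :|: [set y | ~~ g x y]).
    apply: leq_trans (leq_card_setU _ _).1 _; rewrite mul2n -addnn; apply: leq_add => //.
    exact: codegD.
  by apply/setP => y; rewrite !inE.
have small : 4 * h ^ 2 * (2 * D) <= n by move: smallD; rewrite mulnCA !mulnA.
pose Z (p : 'I_h * 'I_h) := [set f in at_pair missing p.1 p.2 | good_off bad p.1 p.2 f].
have off_edge p c d : edges p -> c != d -> (c, d) != p -> (d, c) != p -> off_pair p.1 p.2 c d.
  case: p => a b _ ncd n1 n2; rewrite /off_pair -negb_and !inE /=.
  apply/negP => /andP [/orP [] /eqP ec /orP [] /eqP ed].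
  - by rewrite ec ed eqxx in ncd.
  - by rewrite ec ed eqxx in n1.
  - by rewrite ec ed eqxx in n2.
  - by rewrite ec ed eqxx in ncd.
have goodP p (f : {ffun 'I_h -> 'I_n}) c d : f \in Z p -> c != d -> off_pair p.1 p.2 c d -> ~~ bad (f c) (f d).
  rewrite inE => /andP [_ /forallP /(_ c) /forallP /(_ d) /implyP H] ncd off.
  by apply: H; rewrite ncd.
have Zmiss p (f : {ffun 'I_h -> 'I_n}) : f \in Z p -> missing (f p.1) (f p.2) by rewrite !inE => /andP [].
have Zne p (f : {ffun 'I_h -> 'I_n}) c d : edges p -> f \in Z p -> c != d -> kappa (f c) != kappa (f d).
  move=> ep fZ ncd; have [e|n1] := eqVneq (c, d) p.
    by move: (Zmiss _ _ fZ); rewrite -e => /andP [].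
  have [e|n2] := eqVneq (d, c) p.
    by move: (Zmiss _ _ fZ); rewrite -e eq_sym => /andP [].
  by have := goodP _ _ _ _ fZ ncd (off_edge _ _ _ ep ncd n1 n2); rewrite negb_or => /andP [].
apply: (leq_trans (n := 4 * \sum_(p | edges p) #|Z p|)).
  rewrite !big_distrr /=; apply: leq_sum => p ep.
  by apply: card_good_off bad_sym badD small _; apply: edge_neq.
rewrite leq_mul2l /=; apply: card_disjoint_ge => [p ep|p q f ep eq fp fq].
  apply/subsetP => f fZ; rewrite in_setD; apply/andP; split.
    apply/negP => /embP [_ Hf]; move: (Zmiss _ _ fZ) => /andP [] /negP [].
    by apply: Hf; case/andP: ep.
  apply/embP; split.
    move=> c d fcd; apply/eqP; apply: contraT => ncd.
    by have := Zne _ _ _ _ ep fZ ncd; rewrite fcd eqxx.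
  by move=> c d ecd; apply: Zne ep fZ _; apply: contraTneq ecd => ->; rewrite irrH.
(* If [f] were counted at both [p] and [q], then [p], being off [q], would be sent to an adjacent
   pair, yet it is sent to a missing one. The orientation of [edges] excludes that [q] is [p]
   reversed. *)
apply/eqP; apply: contraT => npq.
have sw : (p.2, p.1) != q.
  apply: contraTneq eq => <-; rewrite /edges /= negb_and -leqNgt.
  by case/andP: ep => /ltnW ->.
have off := off_edge q p.1 p.2 eq (edge_neq ep).
rewrite -surjective_pairing in off; have {}off := off npq sw.
have := goodP _ _ _ _ fq (edge_neq ep) off.
by case/andP: (Zmiss _ _ fp) => nm _; rewrite /bad nm orbT.
Qed.

(** Let I and M be the sums over the edges of H of the maps hitting inner and missing pairs. The two
    counts and [leK] give [3 M <= 4 I], and [inner_missing] gives [2 I <= M]; hence M = 0. As H has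
    an edge, no pair is missing, and then none is inner. *)
Lemma multipartite_of_emb_max a0 b0 : eH a0 b0 -> #|K| <= #|emb eH g| ->
  g =2 multipartite kappa.
Proof.
move=> e0 leK.
have nab : a0 != b0 by apply: contraTneq e0 => ->; rewrite irrH.
have [p0 ep0] : exists p, edges p.
  have [lt|lt|/val_inj ab] := ltngtP a0 b0; first by exists (a0, b0); rewrite /edges /= lt.
    by exists (b0, a0); rewrite /edges /= lt symH.
  by rewrite ab eqxx in nab.
have le1 := card_emb_not_multipartite; have le2 := card_multipartite_not_emb.
have eK := cardsID (emb eH g) K; have eG := cardsID K (emb eH g).
rewrite setIC in eK.
have [n0 u v|n_gt0] := posnP n; first by have := ltn_ord u; rewrite [X in _ < X]n0.
have pair_le p : edges p -> 2 * #|at_pair inner p.1 p.2| <= #|at_pair missing p.1 p.2|.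
  move=> ep; have n2 : 0 < n ^ 2 by rewrite expn_gt0 n_gt0.
  rewrite -(leq_pmul2l n2) mulnCA !card_at_pair ?edge_neq // mulnA leq_mul2r.
  by rewrite inner_missing orbT.
have sum_le : 2 * (\sum_(p | edges p) #|at_pair inner p.1 p.2|) <=
               \sum_(p | edges p) #|at_pair missing p.1 p.2|.
  by rewrite big_distrr /=; apply: leq_sum.
have S0 : \sum_(p | edges p) #|at_pair missing p.1 p.2| = 0 by lia.
have m0 : rsize missing = 0.
  have /eqP := card_at_pair missing (edge_neq ep0).
  move: S0; rewrite (bigD1 p0) //= => /eqP; rewrite addn_eq0 => /andP [/eqP -> _].
  by rewrite muln0 eq_sym muln_eq0 expn_eq0 (gtn_eqF n_gt0) orbF => /eqP.
have i0 : rsize inner = 0 by lia.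
have rsize0 (R : rel 'I_n) : rsize R = 0 -> forall u v, R u v = false.
  move=> R0 u v; have : (R u v : nat) <= rsize R.
    by rewrite /rsize (bigD1 u) //= (bigD1 v) //= -addnA leq_addr.
  by rewrite R0 leqn0 eqb0 => /negbTE.
move=> u v; move: (rsize0 _ m0 u v) (rsize0 _ i0 u v); rewrite /missing /inner /multipartite.
by case: (g u v); case: eqP.
Qed.

End CompareMultipartite.

(** * Moving a vertex from a larger to a smaller part *)

Lemma perm_of_fibres n (T : eqType) (F G : 'I_n -> T) :
  (forall t, #|[set x | F x == t]| = #|[set x | G x == t]|) ->
  exists s : 'S_n, forall x, F x = G (s x).
Proof.
move=> fib.
have /tuple_permP [s es] : perm_eq [tuple F i | i < n] [tuple G i | i < n].
  apply/allP => t _ /=; rewrite !count_map; apply/eqP.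
  move: (fib t); rewrite !cardsE !cardE /enum_mem !size_filter.
  by rewrite -!enumT; congr (_ = _); apply: eq_count => x; rewrite inE.
exists s => x; have := congr1 (fun u : seq T => nth (F x) u x) es.
by rewrite -!tnth_nth !tnth_mktuple.
Qed.

Lemma ex_subset_card (T : finType) (A : {set T}) m :
  m <= #|A| -> exists2 B : {set T}, B \subset A & #|B| = m.
Proof.
move=> leA; exists [set x in take m (enum A)].
  by apply/subsetP => x; rewrite inE => /mem_take; rewrite mem_enum.
rewrite cardsE (card_uniqP _) ?take_uniq ?enum_uniq // size_takel // -cardE //.
Qed.

Section Shift.
Variables (h n D : nat) (eH : rel 'I_h) (J : finType) (kappa : 'I_n -> J).
Hypotheses (symH : symmetric eH) (irrH : irreflexive eH).
Variables (i j : J) (a0 b0 : 'I_h).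
Hypothesis e0 : eH a0 b0.
Let part k := [set y | kappa y == k].
Hypothesis partD : forall k, #|part k| <= D.
Hypothesis smallD : 16 * h ^ 3 * D <= n.
Hypothesis unbal : #|part j| + 2 <= #|part i|.

Section Moved.
Variables (z : 'I_n) (W : {set 'I_n}).
Hypotheses (zi : kappa z = i) (Wi : W \subset part i :\ z).
(** With this size, part [i] without [z] and [W] is as large as part [j]. So outside [W], moving [z]
    to part [j] merely exchanges the sizes of the two parts. *)
Hypothesis cardW : #|W| = #|part i| - #|part j| - 1.

Let nij : i != j.
Proof. by apply/eqP => eij; move: unbal; rewrite eij; lia. Qed.

Definition moved x := if x == z then j else kappa x.

Let WP x : x \in W -> x != z /\ kappa x = i.
Proof. by move/(subsetP Wi); rewrite !inE => /andP [-> /eqP ->]. Qed.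

Let zW : z \notin W.
Proof. by apply/negP => /WP []; rewrite eqxx. Qed.

Definition misses (f : {ffun 'I_h -> 'I_n}) := [forall a, f a \notin W].

(* Outside W both colourings have the same multiset of part sizes. *)
Lemma card_emb_misses :
  #|[set f in emb eH (multipartite kappa) | misses f]| <=
  #|[set f in emb eH (multipartite moved) | misses f]|.
Proof.
have ar1 a b c d w : b + 2 <= a -> w = a - b - 1 -> a = true + c -> w + d = c -> b = d.
  by lia.
have ar2 a b d w : b + 2 <= a -> w = a - b - 1 -> w + d = a -> d = ~~ false + b.
  by lia.
(* The value [None] makes the matching permutation preserve [W]; [tperm i j] accounts for the
   exchange of the two sizes. *)
pose F x := if x \in W then None else Some (tperm i j (kappa x)).
pose G x := if x \in W then None else Some (moved x).
have [t|s Hs] := @perm_of_fibres n _ F G.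
  case: t => [k|]; last first.
    by apply: eq_card => x; rewrite !inE /F /G; case: (x \in W).
  have eF : [set x | F x == Some k] = part (tperm i j k) :\: W.
    apply/setP => x; rewrite !inE /F; case: (x \in W) => //=.
    by rewrite (inj_eq Some_inj) (can2_eq (tpermK i j) (tpermK i j)).
  have eG : [set x | G x == Some k] = [set x | moved x == k] :\: W.
    by apply/setP => x; rewrite !inE /G; case: (x \in W).
  rewrite eF eG.
  have Wp : W \subset part i by apply: subset_trans Wi (subsetDl _ _).
  have disW l : l != i -> part l :\: W = part l.
    move=> nl; apply/setP => x; rewrite !inE andbC andb_idr // => /eqP kx.
    by apply: contra nl => /WP [_ <-]; rewrite kx.
  have [->|nki] := eqVneq k i.
    rewrite tpermL disW 1?eq_sym //.
    have -> : [set x | moved x == i] :\: W = (part i :\ z) :\: W.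
      apply/setP => x; rewrite !inE /moved; case: (eqVneq x z) => //=.
      by rewrite eq_sym (negPf nij).
    have := cardsID W (part i :\ z); rewrite (setIidPr Wi).
    have := cardsD1 z (part i); rewrite inE zi eqxx; exact: ar1 unbal cardW.
  have [->|nkj] := eqVneq k j.
    rewrite tpermR.
    have -> : [set x | moved x == j] :\: W = z |: part j.
      apply/setP => x; rewrite !inE /moved; case: (eqVneq x z) => [->|_] /=.
        by rewrite eqxx zW.
      rewrite andbC andb_idr // => /eqP kx; apply/negP => /WP [_]; rewrite kx => ji.
      by move: nij; rewrite ji eqxx.
    have := cardsID W (part i); rewrite (setIidPr Wp) cardsU1 inE zi (negPf nij).
    exact: ar2 unbal cardW.
  rewrite tpermD 1?eq_sym //; apply: eq_card => x; rewrite !inE /moved; case: (eqVneq x z) => //= ->.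
  by rewrite zi eq_sym (negPf nki) eq_sym (negPf nkj).
pose ps (f : {ffun 'I_h -> 'I_n}) : {ffun 'I_h -> 'I_n} := [ffun x => s (f x)].
have psinj : injective ps.
  move=> f1 f2 /ffunP e; apply/ffunP => x; move: (e x); rewrite !ffunE; exact: perm_inj.
rewrite -(card_imset _ psinj); apply: subset_leq_card; apply/subsetP => _ /imsetP [f + ->].
rewrite inE => /andP [/embP [injf Hf] /forallP mf].
have sW x : x \notin W -> (s x \notin W) /\ moved (s x) = tperm i j (kappa x).
  move=> xW; move: (Hs x); rewrite /F /G (negPf xW); case: ifP => // _ [] ->; by [].
rewrite inE; apply/andP; split; last first.
  by apply/forallP => a; rewrite ffunE; case: (sW _ (mf a)).
apply/embP; split; first by move=> x y; rewrite !ffunE => /perm_inj /injf.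
move=> a b /Hf; rewrite /multipartite !ffunE.
have [_ ->] := sW _ (mf a); have [_ ->] := sW _ (mf b).
by apply: contra => /eqP /perm_inj ->.
Qed.

Let R : rel 'I_n := fun x y => (x == z) && (y \in W).

Let W_gt0 : 0 < #|W|. Proof. by rewrite cardW; move: unbal; lia. Qed.
Let n_gt0 : 0 < n. Proof. by case: (z) => m; apply: leq_ltn_trans. Qed.
Let h_gt0 : 0 < h. Proof. by case: (a0) => m; apply: leq_ltn_trans. Qed.
Let nab0 : a0 != b0. Proof. by apply: contraTneq e0 => ->; rewrite irrH. Qed.

Let card_R (a b : 'I_h) : a != b -> #|at_pair R a b| = #|at_pair R a0 b0|.
Proof.
move=> nab; apply/eqP; rewrite -(@eqn_pmul2l (n ^ 2)) ?expn_gt0 ?n_gt0 //.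
by rewrite !card_at_pair.
Qed.

(** A lost embedding meets [W], and it has an edge from [z] to a vertex of part [j], since only [z]
    was recoloured. For each of at most [h ^ 3] triples of coordinates, the third one must fall into
    part [j], which has probability at most [D / n]. *)
Let hits_lost : 4 * #|[set f in emb eH (multipartite kappa) | ~~ misses f] :\:
  emb eH (multipartite moved)| <= #|at_pair R a0 b0|.
Proof.
pose B (t : 'I_h * 'I_h * 'I_h) := [set f : {ffun 'I_h -> 'I_n} |
  R (f t.1.1) (f t.1.2) && (f t.2 \in part j)].
pose Q (t : 'I_h * 'I_h * 'I_h) := [&& t.1.1 != t.1.2, t.1.1 != t.2 & t.1.2 != t.2].
have cov : #|[set f in emb eH (multipartite kappa) | ~~ misses f] :\:
  emb eH (multipartite moved)| <= \sum_(t | Q t) #|B t|.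
  apply: card_cover_le => f; rewrite in_setD inE => /andP [nK' /andP [/embP [injf Hf]]].
  rewrite negb_forall => /existsP [c]; rewrite negbK => cW.
  have [p /and3P [ep /eqP p1 p2]|none] :=
    pickP (fun p => [&& eH p.1 p.2, f p.1 == z & f p.2 \in part j]).
    have [ncz kc] := WP cW.
    have nz2 : f p.2 != z.
      by apply: contraTneq p2 => ->; rewrite inE zi.
    exists (p.1, c, p.2); rewrite /Q ?inE /=.
      apply/and3P; split.
      - by apply: contraNneq ncz => <-; rewrite p1.
      - by apply: contraNneq nz2 => <-; rewrite p1.
      apply: contraTneq p2 => <-; by rewrite inE kc.
    by move: p2; rewrite inE /R p1 eqxx cW.
  case/negP: nK'; apply/embP; split=> // a b eab.
  move: (Hf _ _ eab) (none (a, b)) (none (b, a)).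
  rewrite /= eab symH eab /= !inE /multipartite /moved.
  case: (eqVneq (f a) z) => [fa|_]; case: (eqVneq (f b) z) => [fb|_] //=.
  - by rewrite fa fb eqxx.
  - by move=> _ H _; rewrite eq_sym H.
  - by move=> _ _ H; rewrite H.
have leB t : Q t -> n * #|B t| <= D * #|at_pair R a0 b0|.
  case: t => [[a c] b] /and3P [/= nac nab ncb]; rewrite -(card_R nac).
  apply: (@card_upd_le _ _ b (fun f => R (f a) (f c)) (fun _ y => y \in part j)) => //.
    by move=> f x; rewrite !upd_other.
  move=> f; apply: leq_trans (partD j); rewrite leq_eqVlt; apply/orP; left; apply/eqP.
  by apply: eq_card => x; rewrite inE.
have le2 : n * (4 * \sum_(t | Q t) #|B t|) <= n * #|at_pair R a0 b0|.
  rewrite mulnCA big_distrr /=.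
  apply: (leq_trans (n := 4 * \sum_(t | Q t) D * #|at_pair R a0 b0|)).
    by rewrite leq_mul2l /=; apply: leq_sum.
  rewrite sum_nat_const !mulnA leq_mul2r; apply/orP; right.
  have lQ : #|Q| <= h ^ 3.
    by apply: leq_trans (max_card _) _; rewrite !card_prod !card_ord -mulnA.
  apply: leq_trans smallD; rewrite leq_mul2r; apply/orP; right.
  by apply: leq_mul.
move: le2; rewrite leq_pmul2l // => le2; apply: leq_trans le2.
by rewrite leq_mul2l cov orbT.
Qed.

(** Send [a0] to [z] and [b0] into [W], both in the old part [i], and let all other pairs have
    different colours before and after the move. Such a map is an embedding only after the move, and
    [card_good_off] keeps three quarters of the candidates. *)
Let hits_gained : 3 * #|at_pair R a0 b0| <= 4 *
  #|[set f in emb eH (multipartite moved) | ~~ misses f] :\: emb eH (multipartite kappa)|.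
Proof.
pose bad : rel 'I_n := fun x y => (kappa x == kappa y) || (moved x == moved y).
have bad_sym : symmetric bad by move=> x y; rewrite /bad eq_sym [moved x == _]eq_sym.
(* The extra 1 is [z], which has joined part [j]. *)
have badD x : #|[set y | bad x y]| <= 2 * D + 1.
  apply: (leq_trans (n := #|part (kappa x) :|: (z |: part (moved x))|)).
    apply: subset_leq_card; apply/subsetP => y; rewrite !inE /bad.
    case/orP => [/eqP ->|/eqP ->]; first by rewrite eqxx.
    by rewrite /moved; case: (eqVneq y z) => [_|_]; rewrite ?eqxx ?orbT.
  apply: leq_trans (leq_card_setU _ _).1 _; have := partD (kappa x); have := partD (moved x).
  rewrite cardsU1; case: (_ \notin _); lia.
have small : 4 * h ^ 2 * (2 * D + 1) <= n.
  have D_gt0 : 0 < D by apply: leq_trans (partD i); move: unbal; lia.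
  apply: leq_trans smallD; rewrite [h ^ 3]expnS; move: (h ^ 2) => q.
  by have : q * D <= h * q * D; nia.
apply: leq_trans (card_good_off R bad_sym badD small nab0) _.
rewrite leq_mul2l /=; apply: subset_leq_card; apply/subsetP => f.
rewrite inE => /andP []; rewrite [f \in at_pair _ _ _]inE => /andP [/eqP fa fb] good.
have [nbz kb] := WP fb.
have ne c d : c != d -> off_pair a0 b0 c d ->
    (kappa (f c) != kappa (f d)) && (moved (f c) != moved (f d)).
  move=> ncd off; rewrite -negb_or.
  by move/forallP: good => /(_ c) /forallP /(_ d) /implyP; rewrite ncd off; apply.
have ne' c d : c != d -> moved (f c) != moved (f d).
  move=> ncd; case: (boolP (off_pair a0 b0 c d)) => [/(ne _ _ ncd) /andP [] //|].
  have mab : moved (f a0) != moved (f b0).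
    by rewrite fa /moved eqxx (negPf nbz) kb eq_sym.
  rewrite /off_pair -negb_and negbK !inE => /andP [/orP [] /eqP ec /orP [] /eqP ed].
  - by rewrite ec ed eqxx in ncd.
  - by rewrite ec ed.
  - by rewrite ec ed eq_sym.
  - by rewrite ec ed eqxx in ncd.
rewrite in_setD; apply/andP; split.
  by apply/negP => /embP [_ /(_ _ _ e0)]; rewrite /multipartite fa kb zi eqxx.
rewrite inE; apply/andP; split.
  apply/embP; split.
    by move=> c d fcd; apply/eqP; apply: contraT => /ne'; rewrite fcd eqxx.
  by move=> c d ecd; apply: ne'; apply: contraTneq ecd => ->; rewrite irrH.
by rewrite negb_forall; apply/existsP; exists b0; rewrite fb.
Qed.

(** Embeddings missing [W] do not decrease in number. Among those hitting [W], at most a quarter of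
    the positive number of maps in [at_pair R a0 b0] is lost and at least three quarters are
    gained. *)
Lemma card_emb_moved : #|emb eH (multipartite kappa)| < #|emb eH (multipartite moved)|.
Proof.
have R_gt0 : 0 < #|at_pair R a0 b0|.
  rewrite -(@ltn_pmul2l (n ^ 2)) ?expn_gt0 ?n_gt0 // muln0 card_at_pair //.
  rewrite muln_gt0 expn_gt0 n_gt0 andbT /rsize (bigD1 z) //= /R eqxx /=.
  by rewrite -(card_sum_bool (mem W)) addn_gt0 cardsE W_gt0.
have cards_split (E : {set {ffun 'I_h -> 'I_n}}) :
    #|[set f in E | misses f]| + #|[set f in E | ~~ misses f]| = #|E|.
  rewrite -(cardsID [set f | misses f] E).
  by congr (_ + _); apply: eq_card => f; rewrite !inE // andbC.
have := card_emb_misses; have := hits_lost; have := hits_gained.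
have := cards_split (emb eH (multipartite kappa)); have := cards_split (emb eH (multipartite moved)).
set K := emb eH (multipartite kappa); set K' := emb eH (multipartite moved).
set HK := [set f in K | ~~ misses f]; set HK' := [set f in K' | ~~ misses f].
have := cardsID K' HK; have := cardsID K HK'.
have -> : HK' :&: K = HK :&: K'.
  apply/setP => f; rewrite !in_setI [f \in HK']inE [f \in HK]inE.
  by rewrite andbAC [(f \in K') && _]andbC andbAC.
lia.
Qed.

End Moved.

Lemma multipartite_shift :
  exists kappa' : 'I_n -> J, #|emb eH (multipartite kappa)| < #|emb eH (multipartite kappa')|.
Proof.
have /card_gt0P [z zi] : 0 < #|part i| by move: unbal; lia.
have [|W Wi cW] := @ex_subset_card _ (part i :\ z) (#|part i| - #|part j| - 1).
  by have := cardsD1 z (part i); rewrite zi; lia.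
exists (moved z); apply: card_emb_moved Wi cW.
by move: zi; rewrite inE => /eqP.
Qed.

End Shift.

(** * Balanced colourings and residue classes *)

Lemma sum_mod_eq r n i : i < r -> \sum_(y < n) (y %% r == i : nat) = n %/ r + (i < n %% r).
Proof.
move=> lt_ir; have r_gt0 : 0 < r by apply: leq_ltn_trans lt_ir.
elim: n => [|n IH]; first by rewrite big_ord0 div0n mod0n.
rewrite big_ord_recr /= IH divnS // modnS; have := ltn_pmod n r_gt0.
case: ifP => [dv lt|nd _].
  have : n.+1 %% r = 0 by apply/eqP.
  rewrite -addn1 -modnDml addn1 => e; have [lt'|ge'] := ltnP (n %% r).+1 r.
    by rewrite modn_small in e.
  by move: (n %% r) (n %/ r) lt ge' => m q *; case: eqP; lia.
by move: (n %% r) (n %/ r) => m q; case: eqP; lia.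
Qed.

Lemma sum_fibres (n r : nat) (kappa : 'I_n -> 'I_r) :
  \sum_i #|[set y | kappa y == i]| = n.
Proof.
under eq_bigr do rewrite card_sum_bool.
rewrite exchange_big /= -[RHS]card_ord -sum1_card; apply: eq_bigr => y _.
by rewrite (bigD1 (kappa y)) //= eqxx big1 // => i; rewrite eq_sym => /negPf ->.
Qed.

Definition balanced (r : nat) (F : 'I_r -> nat) := forall i j, F i <= F j + 1.

(** All values are [m] or [m + 1] for the minimum [m]. The minimum is attained, so fewer than [r]
    values are larger, and division with remainder identifies [m] and their number. Thus [r] and the
    sum determine all sizes up to order. *)
Lemma card_balanced_fibre r (F : 'I_r -> nat) t : balanced F ->
  let n := \sum_i F i in
  #|[set i | F i == t]| =
    if t == n %/ r then r - n %% r else if t == (n %/ r).+1 then n %% r else 0.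
Proof.
move=> bal n; have [r0|r_gt0] := posnP r.
  have -> : #|[set i | F i == t]| = 0.
    by apply/eqP; rewrite -leqn0; apply: leq_trans (max_card _) _; rewrite card_ord r0.
  have n0 : n = 0 by rewrite /n big1 // => i _; have := ltn_ord i; rewrite [X in _ < X]r0.
  by rewrite n0 mod0n subn0 [X in if _ then X else _]r0; case: (_ == _) => //; case: (_ == _).
have [i0 min0] : exists i0, forall i, F i0 <= F i.
  by case: (arg_minnP F (erefl true : xpredT (Ordinal r_gt0))) => i0 _ H; exists i0 => i; apply: H.
set m := F i0 in min0; pose b i := F i != m.
have Fb i : F i = m + b i.
  by have := min0 i; have := bal i i0; rewrite /b -/m; case: eqP; lia.
have sumb : \sum_i (b i : nat) < r.
  rewrite -[X in _ < X]card_ord -sum1_card (bigD1 i0) //= [X in _ < X](bigD1 i0) //=.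
  by rewrite {1}/b eqxx ltnS; apply: leq_sum => i _; case: (b i).
have en : n = m * r + \sum_i (b i : nat).
  by rewrite /n (eq_bigr _ (fun i _ => Fb i)) big_split /= sum_nat_const card_ord mulnC.
have -> : n %/ r = m by rewrite en divnMDl // divn_small // addn0.
have -> : n %% r = \sum_i (b i : nat) by rewrite en modnMDl modn_small.
have eb : \sum_i (~~ b i : nat) + \sum_i (b i : nat) = r.
  by rewrite -big_split /= -[RHS]card_ord -sum1_card; apply: eq_bigr => i _; case: (b i).
rewrite card_sum_bool; case: eqP => [->|nm].
  rewrite (eq_bigr (fun i => ~~ b i : nat)) => [|i _]; last by rewrite /b negbK.
  by rewrite -[X in X - _]eb addnK.
case: eqP => [->|nm1]; last first.
  by rewrite big1 // => i _; rewrite Fb; case: eqP => //; case: (b i); lia.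
by apply: eq_bigr => i _; rewrite Fb; case: (b i); case: eqP; lia.
Qed.

Section Residues.
Variables (r n : nat) (r_gt0 : 0 < r).

Definition residue (x : 'I_n) : 'I_r := Ordinal (ltn_pmod x r_gt0).

Lemma card_residue i : #|[set y | residue y == i]| = n %/ r + (i < n %% r).
Proof. by rewrite card_sum_bool -sum_mod_eq. Qed.

(** Two matchings: [s] renames the colours so that the part sizes agree, then [p] renames the
    vertices so that the parts themselves agree. *)
Lemma card_emb_balanced_le h (eH : rel 'I_h) (kappa : 'I_n -> 'I_r) :
  balanced (fun i => #|[set y | kappa y == i]|) ->
  #|emb eH (multipartite kappa)| <= #|emb eH (multipartite residue)|.
Proof.
move=> balk.
have balr : balanced (fun i => #|[set y | residue y == i]|).
  by move=> i j; rewrite !card_residue; do 2 case: (_ < _); lia.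
have [t|s Hs] := @perm_of_fibres r _ (fun i => #|[set y | kappa y == i]|)
    (fun i => #|[set y | residue y == i]|).
  by rewrite (card_balanced_fibre t balk) (card_balanced_fibre t balr) /= !sum_fibres.
have [t|p Hp] := @perm_of_fibres n _ (fun x => s (kappa x)) residue.
  rewrite -[in RHS](permKV s t) -Hs; apply: eq_card => x; rewrite !inE.
  by rewrite (can2_eq (permK s) (permKV s)).
pose ps (f : {ffun 'I_h -> 'I_n}) : {ffun 'I_h -> 'I_n} := [ffun x => p (f x)].
have psinj : injective ps.
  move=> f1 f2 /ffunP e; apply/ffunP => x; move: (e x); rewrite !ffunE; exact: perm_inj.
rewrite -(card_imset _ psinj); apply: subset_leq_card; apply/subsetP => _ /imsetP [f + ->].
case/embP=> injf Hf; apply/embP; split; first by move=> x y; rewrite !ffunE => /perm_inj /injf.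
by move=> a b /Hf; rewrite /multipartite !ffunE -!Hp (inj_eq (@perm_inj _ s)).
Qed.

End Residues.

Lemma eq_emb h n (eH : rel 'I_h) (g g' : rel 'I_n) : g =2 g' -> emb eH g = emb eH g'.
Proof.
move=> e; apply/setP => f; apply/embP/embP => -[injf Hf]; split=> // a b /Hf;
  by rewrite e.
Qed.

Lemma extremal_le_residue h n r (r_gt0 : 0 < r) (eH : rel 'I_h) (g : rel 'I_n) :
  0 < h -> 300 * h ^ 9 <= r -> 64 * h ^ 6 <= n ->
  symmetric eH -> irreflexive eH -> extremal r eH g ->
  #|emb eH g| <= #|emb eH (multipartite (@residue r n r_gt0))|.
Proof.
move=> h_gt0 le_r le_n symH irrH ext.
(* If H has no edge, every injective map is an embedding into any graph. *)
have [[a0 b0] /= e0|none] := pickP (fun p => eH p.1 p.2); last first.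
  apply: subset_leq_card; apply/subsetP => f /embP [injf _]; apply/embP; split=> // a b.
  by rewrite (none (a, b)).
have [gsym girr gfree gmax] := ext.
(* This is the bound of [codeg_le] for residue classes, which have at most [n %/ r + 1] elements. *)
set D := h ^ 3 * (n %/ r + 1) + h ^ 2.
have codegD v : codeg g v <= D.
  apply: codeg_le ext irrH e0 _ => x; rewrite [X in #|pred_of_set X|](_ : _ =
    [set y | @residue r n r_gt0 y == @residue r n r_gt0 x]).
    by rewrite card_residue leq_add2l; case: (_ < _).
  by apply/setP => y; rewrite !inE eq_sym.
(* The main term [16 * h ^ 6 * (n %/ r)] is at most [16 n / 300] because [r >= 300 * h ^ 9]; the
   remaining terms are at most [32 * h ^ 6], hence at most [n / 2]. *)
have smallD : 16 * h ^ 3 * D <= n.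
  have le_q : n %/ r * (300 * h ^ 9) <= n.
    by apply: leq_trans (leq_trunc_div n r); rewrite leq_mul2l le_r orbT.
  have le69 : h ^ 6 <= h ^ 9 by rewrite leq_pexp2l.
  have le56 : h ^ 5 <= h ^ 6 by rewrite leq_pexp2l.
  have -> : 16 * h ^ 3 * D = 16 * (h ^ 6 * (n %/ r)) + 16 * h ^ 6 + 16 * h ^ 5.
    by rewrite /D; lia.
  have : h ^ 6 * (n %/ r) <= h ^ 9 * (n %/ r) by rewrite leq_mul2r le69 orbT.
  move: le_q le_n le56; move: (h ^ 6) (h ^ 9) (h ^ 5) (n %/ r) => x y w q; lia.
have small8 : 8 * h ^ 2 * D <= n.
  apply: leq_trans smallD; rewrite leq_mul2r; apply/orP; right.
  by rewrite leq_mul // leq_pexp2l.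
have [kap [kap_lt kap_sz kap_B]] := @greedy_partition n D g gsym girr codegD r setT
  (fun T _ => gfree T).
pose kappa x : 'I_r := Ordinal (kap_lt x (in_setT x)).
have sumT (F : 'I_n -> 'I_n -> nat) :
    \sum_(u in setT) \sum_(v in setT) F u v = \sum_u \sum_v F u v.
  by apply: eq_big => [u|u _]; rewrite ?in_setT //; apply: eq_bigl => v; rewrite in_setT.
have partD x : #|[set y | kappa x == kappa y]| <= D.
  apply: leq_trans (kap_sz x (in_setT x)); apply: subset_leq_card.
  by apply/subsetP => y; rewrite !inE.
have im : 2 * rsize (inner g kappa) <= rsize (missing g kappa).
  by move: kap_B; rewrite !sumT.
have maxk (kap' : 'I_n -> 'I_r) : #|emb eH (multipartite kap')| <= #|emb eH g|.
  apply: gmax; [exact: multipartite_sym | exact: multipartite_irr |].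
  exact: multipartite_clique_free.
have eg := multipartite_of_emb_max symH irrH gsym codegD partD small8 im e0 (maxk kappa).
rewrite (eq_emb eH eg); apply: card_emb_balanced_le => i j; rewrite leqNgt; apply/negP => lt.
have partD' k : #|[set y | kappa y == k]| <= D.
  have [->|[x]] := set_0Vmem [set y | kappa y == k]; first by rewrite cards0.
  rewrite inE => /eqP <-; apply: leq_trans (partD x).
  by apply: subset_leq_card; apply/subsetP => y; rewrite !inE eq_sym.
have unbal : #|[set y | kappa y == j]| + 2 <= #|[set y | kappa y == i]| by move: lt; rewrite addn1 addn2.
have [kap'] := multipartite_shift symH irrH e0 partD' smallD unbal.
by rewrite -(eq_emb eH eg) ltnNge maxk.
Qed.

(** * Edge sets versus relations, and copies versus embeddings *)

Definition adj n (G : {set {set 'I_n}}) : rel 'I_n := fun u v => [set u; v] \in G.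

Lemma adj_sym n (G : {set {set 'I_n}}) : symmetric (adj G).
Proof. by move=> u v; rewrite /adj setUC. Qed.

Lemma adj_irr n (G : {set {set 'I_n}}) : simple_graph G -> irreflexive (adj G).
Proof.
move=> /forallP sG u; apply/negP; rewrite /adj setUid => uG.
by have := sG [set u]; rewrite uG cards1.
Qed.

Definition graph_of n (g : rel 'I_n) : {set {set 'I_n}} :=
  [set e : {set 'I_n} | [exists u : 'I_n, exists v : 'I_n, g u v && (e == [set u; v])]].

Lemma graph_ofP n (g : rel 'I_n) e :
  reflect (exists u v, g u v /\ e = [set u; v]) (e \in graph_of g).
Proof.
rewrite inE; apply: (iffP existsP) => [[u /existsP [v /andP [guv /eqP ->]]]|[u [v [guv ->]]]].
  by exists u, v.
by exists u; apply/existsP; exists v; rewrite guv eqxx.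
Qed.

Lemma simple_graph_of n (g : rel 'I_n) : irreflexive g -> simple_graph (graph_of g).
Proof.
move=> girr; apply/forallP => e; apply/implyP => /graph_ofP [u [v [guv ->]]].
have nuv : u != v by apply: contraTneq guv => ->; rewrite girr.
by rewrite cards2 nuv.
Qed.

Lemma adj_graph_of n (g : rel 'I_n) : symmetric g -> irreflexive g -> adj (graph_of g) =2 g.
Proof.
move=> gsym girr u v; apply/graph_ofP/idP => [[x [y [gxy e]]]|guv]; last by exists u, v.
have := set21 u v; have := set22 u v; rewrite e !inE.
have nxy : x != y by apply: contraTneq gxy => ->; rewrite girr.
have := set21 x y; have := set22 x y; rewrite -e !inE.
case/orP => /eqP ey; case/orP => /eqP ex; rewrite ?ex ?ey in gxy nxy *.
- by rewrite eqxx in nxy.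
- by move=> _ _; rewrite gsym.
- by [].
- by rewrite eqxx in nxy.
Qed.

Lemma simple_edgeP n (G : {set {set 'I_n}}) e : simple_graph G -> e \in G ->
  exists u v, e = [set u; v].
Proof.
by move=> /forallP /(_ e) /implyP H /H /cards2P [u [v [_ ->]]]; exists u, v.
Qed.

Definition edge_image h n (H : {set {set 'I_h}}) (f : 'I_h -> 'I_n) : {set {set 'I_n}} :=
  [set (f @: e : {set 'I_n}) | e : {set 'I_h} in H].

Lemma emb_adjP h n (H : {set {set 'I_h}}) (G : {set {set 'I_n}}) (f : {ffun 'I_h -> 'I_n}) :
  simple_graph H ->
  (f \in emb (adj H) (adj G)) = injectiveb f && (edge_image H f \subset G).
Proof.
have im (a b : 'I_h) : f @: [set a; b] = [set f a; f b] by rewrite imsetU1 imset_set1.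
move=> sH; apply/embP/andP => [[injf Hf]|[/injectiveP injf /subsetP sub]].
  split; first exact/injectiveP.
  apply/subsetP => _ /imsetP [e eH ->]; case: (simple_edgeP sH eH) => a [b eab].
  by rewrite eab im; apply: Hf; rewrite /adj -eab.
split=> // a b eab; rewrite /adj -im; apply: sub; exact: (imset_f (fun e : {set _} => f @: e : {set _})) eab.
Qed.

Definition aut h (H : {set {set 'I_h}}) := [set s : 'S_h | edge_image H s == H].

Lemma aut_gt0 h (H : {set {set 'I_h}}) : 0 < #|aut H|.
Proof.
apply/card_gt0P; exists 1%g; rewrite inE; apply/eqP; apply/setP => e.
have id1 (A : {set 'I_h}) : (1%g : 'S_h) @: A = A.
  by rewrite -[RHS]imset_id; apply: eq_imset => x; rewrite perm1.
apply/imsetP/idP => [[A AH ->]|eH]; first by rewrite id1.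
by exists e; rewrite ?id1.
Qed.

(** Two embeddings have the same image subgraph exactly when they differ by an automorphism of H, so
    all fibres of [phi] have the size of [aut H]. *)
Lemma card_emb_Nsub h n (H : {set {set 'I_h}}) (G : {set {set 'I_n}}) :
  simple_graph H -> #|emb (adj H) (adj G)| = #|aut H| * Nsub H G.
Proof.
move=> sH; pose phi (f : {ffun 'I_h -> 'I_n}) := (f @: [set: 'I_h], edge_image H f).
have copyP p : reflect (exists2 f, f \in emb (adj H) (adj G) & phi f = p) (p \in copies H G).
  rewrite inE; apply: (iffP existsP) => [[f /and4P [injf /eqP e1 /eqP e2 sub]]|[f fE <-]].
    exists f; last by rewrite [RHS]surjective_pairing e1 e2.
    by rewrite emb_adjP // injf /edge_image -e2.
  by exists f; move: fE; rewrite emb_adjP // => /andP [-> sub]; rewrite !eqxx.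
rewrite -sum1_card (partition_big phi (mem (copies H G))) /=; last first.
  by move=> f fE; apply/copyP; exists f.
rewrite mulnC -sum_nat_const; apply: eq_bigr => p /copyP [f0 f0E <-].
rewrite sum1dep_card.
move: (f0E); rewrite emb_adjP // => /andP [/injectiveP inj0 sub0].
pose tr (s : 'S_h) : {ffun 'I_h -> 'I_n} := [ffun x => f0 (s x)].
have trinj : injective tr.
  by move=> s1 s2 /ffunP e; apply/permP => x; move: (e x); rewrite !ffunE => /inj0.
have im_comp (s : 'I_h -> 'I_h) (f1 : {ffun 'I_h -> 'I_n}) (A : {set 'I_h}) :
    (forall x, f1 x = f0 (s x)) -> f1 @: A = f0 @: (s @: A).
  by move=> e; rewrite -imset_comp; apply: eq_imset.
have ei_comp (s : 'I_h -> 'I_h) (f1 : {ffun 'I_h -> 'I_n}) :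
    (forall x, f1 x = f0 (s x)) ->
    edge_image H f1 = (fun A : {set 'I_h} => f0 @: A : {set 'I_n}) @: edge_image H s.
  by move=> e; rewrite /edge_image -imset_comp; apply: eq_imset => A /=; apply: im_comp.
rewrite -(card_imset _ trinj); apply: eq_card => f; rewrite inE.
apply/andP/imsetP => [[fE /eqP [eV eE]]|[s + ->]]; last first.
  rewrite inE => /eqP autS.
  have e : edge_image H (tr s) = edge_image H f0.
    by rewrite (ei_comp s) ?autS // => x; rewrite ffunE.
  split.
    rewrite emb_adjP // e sub0 andbT; apply/injectiveP => x y.
    by rewrite !ffunE => /inj0 /perm_inj.
  rewrite /phi e xpair_eqE eqxx andbT; apply/eqP.
  rewrite (im_comp s) => [|x]; last by rewrite ffunE.
  suff -> : s @: [set: 'I_h] = setT by [].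
  apply/setP => x; rewrite in_setT; apply/imsetP.
  by exists (s^-1%g x); rewrite ?inE ?permKV.
have /injectiveP injf : injectiveb f by move: fE; rewrite emb_adjP // => /andP [].
have pre x : exists y, f0 y == f x.
  have : f x \in f0 @: [set: 'I_h] by rewrite -eV imset_f.
  by case/imsetP => y _ ->; exists y.
(* Equal vertex images allow [f0] to be inverted on the image of [f]; this is the automorphism with
   [f0 (s0 x) = f x]. *)
pose s0 x := xchoose (pre x).
have s0P x : f0 (s0 x) = f x by apply/eqP; exact: xchooseP (pre x).
have s0inj : injective s0 by move=> x y e; apply: injf; rewrite -!s0P e.
exists (perm s0inj); last by apply/ffunP => x; rewrite ffunE permE s0P.
rewrite inE; apply/eqP; apply: (imset_inj (imset_inj inj0)).
rewrite -[RHS]eE; symmetry; apply: ei_comp => x; by rewrite permE s0P.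
Qed.

(** Since [aut] is nonempty, no copies means no embeddings, and an embedding of the complete graph
    is an enumeration of [r.+1] vertices of a clique. *)
Lemma clique_freeP n r (G : {set {set 'I_n}}) : simple_graph G ->
  reflect (clique_free r (adj G)) (Nsub (complete r.+1) G == 0).
Proof.
move=> sG; have sC : simple_graph (complete r.+1).
  by apply/forallP => e; apply/implyP; rewrite inE.
have adjC (a b : 'I_r.+1) : adj (complete r.+1) a b = (a != b).
  by rewrite /adj inE cards2; case: (a != b).
have -> : (Nsub (complete r.+1) G == 0) = (#|emb (adj (complete r.+1)) (adj G)| == 0).
  by rewrite card_emb_Nsub // muln_eq0 (gtn_eqF (aut_gt0 _)).
apply: (iffP idP) => [E0 T clT|free].
  rewrite leqNgt; apply/negP => ltT.
  have [x0 x0T] : exists x0, x0 \in T by apply/card_gt0P; apply: leq_ltn_trans ltT.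
  pose f : {ffun 'I_r.+1 -> 'I_n} := [ffun i : 'I_r.+1 => nth x0 (enum T) i].
  have lt_i (i : 'I_r.+1) : i < size (enum T).
    by rewrite -cardE; apply: leq_trans (ltn_ord i) ltT.
  have injf : injective f.
    move=> i j; rewrite !ffunE => /eqP; rewrite nth_uniq ?enum_uniq ?lt_i //.
    by move/eqP/val_inj.
  have fT i : f i \in T by rewrite ffunE -mem_enum mem_nth.
  move: E0; rewrite cards_eq0 => /eqP E0; suff : f \in set0 by rewrite inE.
  rewrite -E0; apply/embP; split=> // a b; rewrite adjC => nab.
  by apply: clT => //; rewrite (inj_eq injf).
rewrite cards_eq0; apply/eqP; apply/setP => f; rewrite [RHS]inE; apply/negP => /embP [injf Hf].
have := free (f @: setT); rewrite card_imset // cardsT card_ord ltnn => H.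
suff : false by []; apply: H => _ _ /imsetP [a _ ->] /imsetP [b _ ->] nab.
by apply: Hf; rewrite adjC; apply: contraNneq nab => ->.
Qed.

Theorem theorem1p2 (h : nat) (H : {set {set 'I_h}}) (r : nat) :
  0 < h -> simple_graph H -> 300 * h ^ 9 <= r ->
  exists N : nat, forall n : nat, N <= n ->
    ex n H (complete r.+1) = Nsub H (turan r n).
Proof.
(* The threshold is the one demanded by [extremal_le_residue]. *)
move=> h_gt0 sH le_r; exists (64 * h ^ 6) => n le_n.
have r_gt0 : 0 < r by apply: leq_trans le_r; rewrite muln_gt0 expn_gt0 h_gt0.
pose T := multipartite (@residue r n r_gt0).
have Tsym : symmetric T by apply: multipartite_sym.
have Tirr : irreflexive T by apply: multipartite_irr.
have eT : turan r n = graph_of T by [].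
have sT : simple_graph (turan r n) by rewrite eT; apply: simple_graph_of.
have adjT : adj (turan r n) =2 T by rewrite eT; apply: adj_graph_of.
have freeP (g : rel 'I_n) : symmetric g -> irreflexive g -> clique_free r g ->
    simple_graph (graph_of g) && (Nsub (complete r.+1) (graph_of g) == 0).
  move=> gsym girr gfree; have sg := simple_graph_of girr; rewrite sg /=.
  apply/(clique_freeP r sg) => A clA; apply: gfree => x y xA yA nxy.
  by rewrite -(adj_graph_of gsym girr); apply: clA.
have leE (G G' : {set {set 'I_n}}) :
    (#|emb (adj H) (adj G)| <= #|emb (adj H) (adj G')|) = (Nsub H G <= Nsub H G').
  by rewrite !card_emb_Nsub // leq_pmul2l // aut_gt0.
have Tok : simple_graph (turan r n) && (Nsub (complete r.+1) (turan r n) == 0).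
  by rewrite eT; apply: freeP => //; apply: multipartite_clique_free.
have le_ex (G : {set {set 'I_n}}) : simple_graph G && (Nsub (complete r.+1) G == 0) ->
    Nsub H G <= ex n H (complete r.+1).
  by move=> okG; apply: (leq_bigmax_cond (F := fun G => Nsub H G)).
apply/eqP; rewrite eqn_leq le_ex // andbT.
(* The maximum is attained, as the Turán graph is a competitor. An optimal [G] is extremal for
   embeddings too, both counts differing by the factor [#|aut H|]. *)
have [|G okG exG] := @eq_bigmax_cond _
    [pred G : {set {set 'I_n}} | simple_graph G && (Nsub (complete r.+1) G == 0)]
    (fun G => Nsub H G).
  by apply/card_gt0P; exists (turan r n).
have {}exG : ex n H (complete r.+1) = Nsub H G by apply: exG.
have {okG} /andP [sG freeG] : simple_graph G && (Nsub (complete r.+1) G == 0) by [].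
rewrite exG -leE (eq_emb _ adjT); apply: extremal_le_residue => //.
- exact: adj_sym.
- exact: adj_irr.
split; [exact: adj_sym | exact: adj_irr | exact/(clique_freeP r sG) |].
move=> g gsym girr gfree; rewrite -(eq_emb _ (adj_graph_of gsym girr)) leE -exG.
by apply: le_ex; apply: freeP.
Qed.
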